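(* Let $p$ be a prime and $q=p^2$, and let $\vec r=(r_1,r_2)$ be integers with $0\le r_2\le r_1<p-r_2$. Then there is an isomorphism of $\mathrm{GL}_2(\mathbb F_p)$-representations $$V_{\vec r}|_{\mathrm{GL}_2(\mathbb F_p)}\cong V_{r_1+r_2}\oplus V_{r_1+r_2-2}(1)\oplus\cdots\oplus V_{r_1-r_2}(r_2)=\bigoplus_{i=0}^{r_2}V_{r_1+r_2-2i}(i).$$
   Context: All representations are over a fixed algebraic closure $\overline{\mathbb F}_p$ of $\mathbb F_p$. For $r\ge 0$, $\mathrm{Sym}^r(\overline{\mathbb F}_p^2)$ is the $(r+1)$-dimensional space of homogeneous polynomials of degree $r$ in two variables $x,y$ over $\overline{\mathbb F}_p$, with $\begin{pmatrix}a&b\\c&d\end{pmatrix}\cdot P(x,y)=P(ax+cy,bx+dy)$. As a representation of $\mathrm{GL}_2(\mathbb F_p)$, $V_r(k)=\mathrm{Sym}^r(\overline{\mathbb F}_p^2)\otimes\det^k$ and $V_r=V_r(0)$. For $q=p^2$ and $\vec r=(r_1,r_2)$, $V_{\vec r}$ is the representation of $\mathrm{GL}_2(\mathbb F_q)$ on $\mathrm{Sym}^{r_1}(\overline{\mathbb F}_p^2)\otimes\mathrm{Sym}^{r_2}(\overline{\mathbb F}_p^2)$ in which $\begin{pmatrix}a&b\\c&d\end{pmatrix}$ acts on the first factor by $P(x,y)\mapsto P(ax+cy,bx+dy)$ and on the second factor through $\begin{pmatrix}a^{p}&b^{p}\\c^{p}&d^{p}\end{pmatrix}$, i.e. by $P(x,y)\mapsto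 P(a^px+c^py,b^px+d^py)$. Its restriction to $\mathrm{GL}_2(\mathbb F_p)$ is the ordinary tensor product $V_{r_1}\otimes V_{r_2}$. *)

(* Defs.v *)
From HB Require Import structures.
From mathcomp Require Import all_boot all_order all_fingroup all_algebra.
From mathcomp Require Import all_solvable all_field all_character.
From mathcomp Require Import mpoly.

Set Implicit Arguments.
Unset Strict Implicit.
Unset Printing Implicit Defensive.

Import GRing.Theory.
Local Open Scope ring_scope.

Section SymAction.

Variable K : fieldType.

(* Index 0 is the variable x and index 1 is y: for M = [a b; c d], the         *)
(* polynomial P(x, y) is sent to P(a x + c y, b x + d y).                      *)
Definition linsubst (M : 'M[K]_2) (P : {mpoly K[2]}) : {mpoly K[2]} :=
  P \mPo [tuple \sum_(i < 2) M i j *: 'X_i | j < 2].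

Lemma linsubst1 P : linsubst 1%:M P = P.
Proof.
rewrite /linsubst -[RHS](comp_mpoly_id P); congr (_ \mPo _).
apply: eq_from_tnth => j; rewrite !tnth_mktuple (bigD1 j) //= mxE eqxx scale1r.
by rewrite big1 ?addr0 // => i /negPf ij; rewrite mxE ij scale0r.
Qed.

Lemma linsubstM M N P : linsubst (M *m N) P = linsubst M (linsubst N P).
Proof.
rewrite /linsubst [LHS]comp_mpolyEX (comp_mpolyEX P) raddf_sum /=.
apply: eq_bigr => m _.
rewrite comp_mpolyZ !comp_mpolyX rmorph_prod /=; congr (_ *: _).
apply: eq_bigr => j _; rewrite rmorphXn /= !tnth_mktuple; congr (_ ^+ _).
rewrite raddf_sum /=.
under eq_bigr => i _ do rewrite mxE scaler_suml.
rewrite exchange_big /=; apply: eq_bigr => k _.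
rewrite comp_mpolyZ comp_mpolyXU -tnth_nth tnth_mktuple scaler_sumr.
by apply: eq_bigr => i _; rewrite scalerA mulrC.
Qed.

Lemma linsubst_homog M r P : P \is r.-homog -> linsubst M P \is r.-homog.
Proof.
have lin j : \sum_(i < 2) M i j *: ('X_i : {mpoly K[2]}) \is 1.-homog.
  by apply: rpred_sum => i _; apply/rpredZ; rewrite dhomogX /= mdeg1.
move=> /dhomogP homP; rewrite /linsubst comp_mpolyEX big_seq.
apply: rpred_sum => m /homP /= <-; apply: rpredZ.
rewrite comp_mpolyX mdegE !big_ord_recl !big_ord0 addn0 mulr1 !tnth_mktuple.
by apply: dhomogM; rewrite -[X in X.-homog]mul1n; apply/dhomogMn/lin.
Qed.

(* The monomial x^(r - j) y^j *)
Definition symmon (r : nat) (j : 'I_r.+1) : 'X_{1..2} :=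
  [multinom [tuple (r - j)%N; j : nat]].

(* Column j holds the coordinates of the image of x^(r - j) y^j, so that this  *)
(* matrix acts on COLUMN vectors of coordinates; see sym_mxP.                  *)
Definition sym_mx (r : nat) (M : 'M[K]_2) : 'M[K]_r.+1 :=
  \matrix_(i, j) (linsubst M 'X_[symmon j])@_(symmon i).

Definition symcoord (r : nat) (P : {mpoly K[2]}) : 'cV[K]_r.+1 :=
  \col_i P@_(symmon i).

Lemma symmon_deg r (j : 'I_r.+1) : mdeg (symmon j) = r.
Proof.
rewrite mdegE !big_ord_recl big_ord0 addn0 !multinomE !(tnth_nth 0%N) /=.
by rewrite subnK // -ltnS.
Qed.

Lemma symmonP r (m : 'X_{1..2}) : mdeg m = r -> exists j : 'I_r.+1, m = symmon j.
Proof.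
rewrite mdegE !big_ord_recl big_ord0 addn0 => degm.
have mr : (m (lift ord0 ord0) < r.+1)%N by rewrite ltnS -degm leq_addl.
exists (Ordinal mr); apply/mnmP => -[[|[|//]] ii].
  rewrite multinomE (tnth_nth 0%N) /= -degm addnK; congr (m _); exact: val_inj.
by rewrite multinomE (tnth_nth 0%N) /=; congr (m _); exact: val_inj.
Qed.

Lemma symmon_inj r : injective (@symmon r).
Proof.
move=> i j /mnmP /(_ (lift ord0 ord0)).
by rewrite !multinomE !(tnth_nth 0%N) => /val_inj.
Qed.

Lemma symcoordK r P : P \is r.-homog ->
  P = \sum_(j < r.+1) symcoord r P j 0 *: 'X_[symmon j].
Proof.
move=> homP; apply/mpolyP => m; rewrite raddf_sum /=.
under eq_bigr => j _ do rewrite mcoeffZ mcoeffX mxE.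
have [degm|degm] := eqVneq (mdeg m) r; last first.
  rewrite (dhomog_nemf_coeff homP degm) big1 // => j _.
  case: eqP => [jm|_]; last by rewrite mulr0.
  by rewrite -jm symmon_deg eqxx in degm.
have [j ->] := symmonP degm.
rewrite (bigD1 j) //= eqxx mulr1 big1 ?addr0 // => i ij.
by rewrite (inj_eq (@symmon_inj r)) (negPf ij) mulr0.
Qed.

Lemma sym_mxP r M P : P \is r.-homog ->
  symcoord r (linsubst M P) = sym_mx r M *m symcoord r P.
Proof.
move=> homP; apply/colP => i; rewrite [LHS]mxE [RHS]mxE {1}(symcoordK homP).
rewrite /linsubst (raddf_sum (comp_mpoly _)) raddf_sum /=.
apply: eq_bigr => j _.
by rewrite comp_mpolyZ mcoeffZ mulrC [in RHS]mxE.
Qed.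

Lemma sym_mx_col r M (j : 'I_r.+1) :
  col j (sym_mx r M) = symcoord r (linsubst M 'X_[symmon j]).
Proof. by apply/colP => i; rewrite !mxE. Qed.

Lemma symmon_homog r (j : 'I_r.+1) : ('X_[symmon j] : {mpoly K[2]}) \is r.-homog.
Proof. by rewrite dhomogX /= symmon_deg. Qed.

Lemma sym_mx1 r : sym_mx r 1%:M = 1%:M.
Proof.
apply/matrixP => i j; rewrite !mxE linsubst1 mcoeffX (inj_eq (@symmon_inj r)).
by rewrite eq_sym.
Qed.

Lemma sym_mxM r M N : sym_mx r (M *m N) = sym_mx r M *m sym_mx r N.
Proof.
apply/matrixP => i j.
have /colP/(_ i) := sym_mxP M (linsubst_homog N (symmon_homog j)).
rewrite -linsubstM -!sym_mx_col (colE j (sym_mx r N)) mulmxA -colE.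
by rewrite [LHS]mxE [RHS]mxE.
Qed.

End SymAction.


Section GL2Repr.

Variables (K : fieldType) (F : finFieldType) (f : {rmorphism F -> K}).

(* These are homomorphisms g |-> matrix describing left actions on column      *)
(* vectors. The library reads matrices as acting on row vectors, but           *)
(* prod_repr, dadd_grepr and mx_rsim only involve matrix identities: an        *)
(* invertible B with rG1 g *m B = B *m rG2 g is equally an isomorphism of the  *)
(* column spaces, from rG2 to rG1.                                             *)
Lemma sym_mx_repr r :
  mx_repr 'GL_2[F] (fun g : {'GL_2[F]} => sym_mx r (map_mx f g)).
Proof.
split=> [|g h _ _]; first by rewrite GL_1E map_mx1 sym_mx1.
by rewrite GL_MxE map_mxM sym_mxM.
Qed.

Definition sym_repr r := MxRepresentation (sym_mx_repr r).

Lemma detX_mx_repr k :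
  mx_repr 'GL_2[F] (fun g : {'GL_2[F]} => (f (\det g) ^+ k)%:M : 'M[K]_1).
Proof.
split=> [|g h _ _]; first by rewrite GL_1E det1 rmorph1 expr1n.
by rewrite GL_MxE det_mulmx rmorphM exprMn scalar_mxM.
Qed.

Definition detX_repr k := MxRepresentation (detX_mx_repr k).

(* Sym^r twisted by the k-th power of the determinant. *)
Definition symdet_repr r k := prod_repr (sym_repr r) (detX_repr k).

End GL2Repr.

Section GLmap.

Variables (F1 F2 : finFieldType) (i : {rmorphism F1 -> F2}).

Lemma GLmap_unit (g : {'GL_2[F1]}) : (map_mx i g : 'M_2) \is a GRing.unit.
Proof. by rewrite -[_ \is a _]/(_ \in unitmx) map_unitmx; exact: (GL_unit g). Qed.

Definition GLmap (g : {'GL_2[F1]}) : {'GL_2[F2]} := FinRing.unit _ (GLmap_unit g).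

Lemma GLmapM : {in 'GL_2[F1]%g &, {morph GLmap : g h / (g * h)%g}}.
Proof. by move=> g h _ _; apply: val_inj; rewrite /= map_mxM. Qed.

Canonical GLmap_morphism := Morphism GLmapM.

Lemma GLmap_sub : ('GL_2[F1] \subset GLmap @*^-1 'GL_2[F2])%g.
Proof. by apply/subsetP => g _; rewrite !inE. Qed.

Definition GLres (K : fieldType) n (rG : mx_representation K 'GL_2[F2] n) :=
  subg_repr (morphpre_repr GLmap_morphism rG) GLmap_sub.

End GLmap.

Section Vvec.

Variables (p : nat) (K : fieldType) (Fq : finFieldType).
Variables (chFq : p \in [pchar Fq]) (f : {rmorphism Fq -> K}).

Definition Vvec_repr r1 r2 :=
  prod_repr (sym_repr f r1) (sym_repr (f \o pFrobenius_aut chFq) r2).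

End Vvec.

(* Main.v *)
(** Matrices on the coordinate spaces are compared by pairing them with the row
    vectors of monomials at the points of K^2, which span because K is infinite.
    In these terms V_{r1} (x) V_{r2} consists of the bihomogeneous functions
    Q(w1, w2) of bidegree (r1, r2).  Multiplication by the cross product
    x1 y2 - x2 y1, on which GL_2 acts by det, embeds
    V_{r1-1} (x) V_{r2-1} (x) det in it, and polarization, sending P to the
    coefficient of T^{r2} in P(w1 + T w2), maps V_{r1+r2} to it.  On the diagonal
    w1 = w2 the first vanishes and the second is binomial(r1+r2, r2) P, where the
    binomial coefficient is nonzero because r1 + r2 < p; so the two maps together
    are injective, hence bijective by dimension.  Induct on r2; the Frobenius
    twist disappears on F_p. *)

Require Import Defs.
From HB Require Import structures.
From mathcomp Require Import all_boot all_order all_fingroup all_algebra.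
From mathcomp Require Import all_solvable all_field all_character.
From mathcomp Require Import mpoly.
From mathcomp Require Import zify ring.
Import GRing.Theory.
Local Open Scope ring_scope.
Set Implicit Arguments.
Unset Strict Implicit.
Unset Printing Implicit Defensive.

(** The polynomial [q + 1] has no root, so it is constant. *)
Lemma poly_vanish (K : closedFieldType) (q : {poly K}) :
  (forall t, q.[t] = 0) -> q = 0.
Proof.
move=> q0; have /eqP sz1 : size (q + 1) == 1.
  apply: contraT => /closed_rootP [t]; rewrite rootE hornerD q0 hornerC add0r.
  by rewrite oner_eq0.
have := size1_polyC (eq_leq sz1) => /(canRL (addrK _)) qC.
have [c qc] : exists c, q = c%:P by exists ((q + 1)`_0 - 1); rewrite polyCB.
by have := q0 0; rewrite qc hornerC => ->.
Qed.

(** * Monomials at points and separation by them *)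

Section Monomials.

Variable R : comNzRingType.

Definition monv r (w : 'rV[R]_2) : 'rV[R]_r.+1 :=
  \row_j (w 0 0 ^+ (r - j) * w 0 1 ^+ j).

Lemma monvZ r a w : monv r (a *: w) = a ^+ r *: monv r w.
Proof.
apply/rowP => j; rewrite !mxE !exprMn.
rewrite mulrACA -exprD subnK //; exact: (ltn_ord j).
Qed.

End Monomials.

Lemma map_monv (R S : comNzRingType) (h : {rmorphism R -> S}) r w :
  map_mx h (monv r w) = monv r (map_mx h w).
Proof. by apply/rowP => j; rewrite !mxE rmorphM !rmorphXn. Qed.

Lemma meval_homog (K : fieldType) r (w : 'rV[K]_2) (P : {mpoly K[2]}) :
  P \is r.-homog -> P.@[w 0] = (monv r w *m symcoord r P) 0 0.
Proof.
move=> homP; rewrite [in LHS](symcoordK homP) raddf_sum mxE /=.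
apply: eq_bigr => j _; rewrite mevalZ mevalX mulrC; congr (_ * _).
rewrite !mxE !big_ord_recl big_ord0 mulr1 !multinomE !(tnth_nth 0%N) /=.
by congr (_ ^+ _ * w _ _ ^+ _); exact: val_inj.
Qed.

Lemma linsubst_meval (K : fieldType) (M : 'M[K]_2) P (w : 'rV[K]_2) :
  (linsubst M P).@[w 0] = P.@[(w *m M) 0].
Proof.
rewrite /linsubst comp_mpoly_meval; apply: meval_eq => j.
rewrite tnth_mktuple raddf_sum mxE /=; apply: eq_bigr => i _.
by rewrite mevalZ mevalXU mulrC.
Qed.

(** Substituting and then evaluating amounts to moving the point, so matrix identities can be
    checked on points. *)
Lemma monv_sym (K : fieldType) r (M : 'M[K]_2) (w : 'rV[K]_2) :
  monv r w *m sym_mx r M = monv r (w *m M).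
Proof.
apply/rowP => j; have h := symmon_homog K j.
transitivity ((monv r w *m symcoord r (linsubst M 'X_[symmon j])) 0 0).
  by rewrite -sym_mx_col !mxE; apply: eq_bigr => i _; rewrite !mxE.
rewrite -meval_homog ?linsubst_homog // linsubst_meval (meval_homog _ h).
have -> : symcoord r ('X_[symmon j] : {mpoly K[2]}) = delta_mx j 0.
  apply/colP => i; rewrite !mxE mcoeffX (inj_eq (@symmon_inj r)) andbT.
  by rewrite eq_sym.
by rewrite -colE [LHS]mxE.
Qed.

Definition affine_point (K : fieldType) (t : K) : 'rV[K]_2 := \row_k t ^+ k.

(** At [(1, t)] the entries of [L] are polynomials in [t] whose coefficients are its values on the
    basis. Omitting the point [c] only costs a factor ['X - c%:P]. *)
Lemma monv_separates (K : closedFieldType) (c : K) r a b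
    (L : {linear 'rV[K]_r.+1 -> 'M[K]_(a, b)}) :
  (forall t, t != c -> L (monv r (affine_point t)) = 0) -> forall u, L u = 0.
Proof.
move=> L0 u; apply/matrixP => s t.
pose q := \poly_(j < r.+1) L (delta_mx 0 (inord j)) s t.
have Lq (v : 'rV[K]_r.+1) : L v s t = \sum_j v 0 j * q`_j.
  rewrite [v in LHS]row_sum_delta linear_sum summxE; apply: eq_bigr => j _.
  by rewrite linearZ mxE coef_poly ltn_ord inord_val.
have /eqP : ('X - c%:P) * q = 0.
  apply: poly_vanish => z; rewrite hornerM hornerXsubC.
  have [->|zc] := eqVneq z c; first by rewrite subrr mul0r.
  suff -> : q.[z] = 0 by rewrite mulr0.
  have /matrixP/(_ s t) := L0 z zc; rewrite Lq mxE => <-; rewrite horner_poly.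
  apply: eq_bigr => j _; rewrite !mxE expr0 expr1n mul1r coef_poly ltn_ord.
  by rewrite mulrC.
rewrite mulf_eq0 polyXsubC_eq0 /= => /eqP q0.
by rewrite Lq q0 mxE big1 // => j _; rewrite coef0 mulr0.
Qed.

Definition cross (K : fieldType) (w1 w2 : 'rV[K]_2) : K :=
  w1 0 0 * w2 0 1 - w1 0 1 * w2 0 0.

Lemma det_mx22 (R : comNzRingType) (M : 'M[R]_2) :
  \det M = M 0 0 * M 1 1 - M 0 1 * M 1 0.
Proof.
rewrite (expand_det_row M 0) !big_ord_recl big_ord0 addr0 /cofactor !det_mx11.
rewrite !mxE /= expr0 mul1r expr1 mulN1r mulrN.
by congr (_ * M _ _ - M _ _ * M _ _); exact: val_inj.
Qed.

Lemma cross_mulmx (K : fieldType) (M : 'M[K]_2) w1 w2 :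
  cross (w1 *m M) (w2 *m M) = cross w1 w2 * \det M.
Proof.
have mulE (w : 'rV[K]_2) j : (w *m M) 0 j = w 0 0 * M 0 j + w 0 1 * M 1 j.
  rewrite mxE !big_ord_recl big_ord0 addr0.
  by congr (_ + w _ _ * M _ _); exact: val_inj.
by rewrite /cross !mulE det_mx22; ring.
Qed.

(** * Kronecker products of matrices *)

Section Tensor.

Variable K : fieldType.

Lemma tprod_linearl m1 n1 m2 n2 (B : 'M[K]_(m2, n2)) :
  linear (fun A : 'M[K]_(m1, n1) => tprod A B).
Proof.
elim: m1 => [|m1 IH] c A A' /=; first by rewrite scaler0 addr0.
rewrite (linearP (@usubmx _ 1 m1 n1)) (linearP (@dsubmx _ 1 m1 n1)) IH.
by rewrite -!trowbE linearP scale_col_mx add_col_mx.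
Qed.

Lemma tprod_linearr m1 n1 (A : 'M[K]_(m1, n1)) m2 n2 :
  linear (@tprod K m1 n1 A m2 n2).
Proof.
elim: m1 A => [|m1 IH] A c B B' /=; first by rewrite scaler0 addr0.
by rewrite IH linearP scale_col_mx add_col_mx.
Qed.

HB.instance Definition _ m1 n1 (A : 'M[K]_(m1, n1)) m2 n2 :=
  GRing.isSemilinear.Build _ _ _ _ (@tprod K m1 n1 A m2 n2)
    (GRing.semilinear_linear (@tprod_linearr m1 n1 A m2 n2)).

(* [tprod] with its arguments exchanged, to carry linearity in the first factor. *)
Definition tprodl m1 n1 m2 n2 (B : 'M[K]_(m2, n2)) (A : 'M[K]_(m1, n1)) :=
  tprod A B.

HB.instance Definition _ m1 n1 m2 n2 (B : 'M[K]_(m2, n2)) :=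
  GRing.isSemilinear.Build _ _ _ _ (@tprodl m1 n1 m2 n2 B)
    (GRing.semilinear_linear (@tprod_linearl m1 n1 m2 n2 B)).

Lemma tprodZl m1 n1 m2 n2 a (A : 'M[K]_(m1, n1)) (B : 'M[K]_(m2, n2)) :
  tprod (a *: A) B = a *: tprod A B.
Proof. exact: (linearZZ (tprodl B)). Qed.

Lemma tprodZr m1 n1 m2 n2 a (A : 'M[K]_(m1, n1)) (B : 'M[K]_(m2, n2)) :
  tprod A (a *: B) = a *: tprod A B.
Proof. exact: linearZZ. Qed.

(** Resolving the identity into pure tensors avoids handling the encoding of indices in
    ['I_(n1 * n2)]. *)
Lemma tprod_delta_sum n1 n2 :
  1%:M = \sum_(i < n1) \sum_(j < n2)
    tprod (delta_mx i 0 : 'cV[K]_n1) (delta_mx j 0 : 'cV[K]_n2)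
      *m tprod (delta_mx 0 i : 'rV[K]_n1) (delta_mx 0 j : 'rV[K]_n2).
Proof.
rewrite -tprod1 (mx1_sum_delta _ n1).
transitivity (\sum_i tprod (delta_mx i i : 'M[K]_n1) (1%:M : 'M[K]_n2)).
  exact: (raddf_sum (tprodl 1%:M)).
apply: eq_bigr => i _; rewrite mx1_sum_delta raddf_sum; apply: eq_bigr => j _.
by rewrite -tprodE !mul_delta_mx.
Qed.

Lemma tprod_rows_eq0 n1 n2 n (A : 'M[K]_(n1 * n2, n)) :
  (forall (u : 'rV_n1) (v : 'rV_n2), tprod u v *m A = 0) -> A = 0.
Proof.
move=> A0; rewrite -[A]mul1mx tprod_delta_sum mulmx_suml big1 // => i _.
by rewrite mulmx_suml big1 // => j _; rewrite -mulmxA A0 mulmx0.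
Qed.

Lemma tprod_mul_exists n1 n2 a (b : 'I_n1 -> 'I_n2 -> 'M[K]_(1 * 1, a)) :
  {B | forall (u : 'rV_n1) (v : 'rV_n2),
    tprod u v *m B = \sum_i \sum_j (u 0 i * v 0 j) *: b i j}.
Proof.
exists (\sum_i \sum_j
  tprod (delta_mx i 0 : 'cV[K]_n1) (delta_mx j 0 : 'cV[K]_n2) *m b i j) => u v.
rewrite mulmx_sumr; apply: eq_bigr => i _.
rewrite mulmx_sumr; apply: eq_bigr => j _.
have scal1 (x : 'M[K]_1) : x = x 0 0 *: 1%:M by rewrite scalemx1 -mx11_scalar.
rewrite mulmxA -tprodE -!colE [col i u]scal1 [col j v]scal1 tprodZl tprodZr tprod1.
by rewrite scalerA -scalemxAl mul1mx !mxE.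
Qed.

End Tensor.

Arguments tprod : simpl never.

(** Pairs [(1, s)], [(1, t)] with [t != s] suffice; their cross product is [t - s]. Restricting to a
    nonzero cross product later allows division by it. *)
Lemma tprod_monv_eq0 (K : closedFieldType) r1 r2 n
    (A : 'M[K]_(r1.+1 * r2.+1, n)) :
  (forall w1 w2, cross w1 w2 != 0 ->
    tprod (monv r1 w1) (monv r2 w2) *m A = 0) -> A = 0.
Proof.
move=> A0; apply: tprod_rows_eq0 => u v.
have lin2 s : tprod (monv r1 (affine_point s)) v *m A = 0.
  pose L : {linear 'rV_r2.+1 -> 'M_(1 * 1, n)} :=
    mulmxr A \o @tprod K _ _ (monv r1 (affine_point s)) _ _.
  apply: (@monv_separates _ s _ _ _ L) => t ts; apply: A0.
  by rewrite /cross !mxE !expr0 !expr1 mul1r mulr1 subr_eq0.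
pose L : {linear 'rV_r1.+1 -> 'M_(1 * 1, n)} := mulmxr A \o tprodl v.
exact: (@monv_separates _ 0 _ _ _ L (fun t _ => lin2 t)).
Qed.

Lemma coef_expr_linear (R : comNzRingType) (a b : R) m e :
  ((a%:P + 'X * b%:P) ^+ m)`_e = 'C(m, e)%:R * (a ^+ (m - e) * b ^+ e).
Proof.
have -> : (a%:P + 'X * b%:P) ^+ m
    = \poly_(k < m.+1) ('C(m, k)%:R * (a ^+ (m - k) * b ^+ k)).
  rewrite exprDn poly_def; apply: eq_bigr => k _.
  rewrite exprMn -!polyC_exp mulrCA -polyCM mulrC mul_polyC.
  by rewrite mulr_natl scalerMnl.
rewrite coef_poly; case: ltnP => // /bin_small ->; by rewrite mul0r.
Qed.

(** * Polarization *)

Section Polarization.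

Variable K : closedFieldType.

Definition pencil r (w1 w2 : 'rV[K]_2) : 'rV[{poly K}]_r.+1 :=
  monv r (map_mx polyC w1 + 'X *: map_mx polyC w2).

(* The part of degree [d] in [w2] of the monomials at [w1 + w2]. *)
Definition polar d r (w1 w2 : 'rV[K]_2) : 'rV[K]_r.+1 :=
  map_mx (coefp d) (pencil r w1 w2).

Lemma horner_pencil r w1 w2 j t :
  (pencil r w1 w2 0 j).[t] = monv r (w1 + t *: w2) 0 j.
Proof.
have -> : monv r (w1 + t *: w2) = map_mx (horner_eval t) (pencil r w1 w2).
  rewrite map_monv; congr monv; apply/rowP => k; rewrite !mxE.
  by rewrite rmorphD rmorphM /= !/(horner_eval _ _) !hornerE.
by rewrite [RHS]mxE.
Qed.

(** Evaluating the variable at each [t] reduces this to [monv_sym] at [w1 + t *: w2]. *)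
Lemma pencil_sym r (M : 'M[K]_2) w1 w2 :
  pencil r w1 w2 *m map_mx polyC (sym_mx r M) = pencil r (w1 *m M) (w2 *m M).
Proof.
apply/rowP => j; apply/eqP; rewrite -subr_eq0; apply/eqP/poly_vanish => t.
rewrite hornerD hornerN horner_pencil scalemxAl -mulmxDl -monv_sym !mxE.
rewrite horner_sum; apply/eqP; rewrite subr_eq0; apply/eqP/eq_bigr => k _.
by rewrite hornerM horner_pencil [map_mx _ _ _ _]mxE hornerC mxE.
Qed.

Lemma polar_sym d r (M : 'M[K]_2) w1 w2 :
  polar d r w1 w2 *m sym_mx r M = polar d r (w1 *m M) (w2 *m M).
Proof.
rewrite /polar -pencil_sym; apply/rowP => j; rewrite !mxE raddf_sum /=.
by apply: eq_bigr => k _; rewrite mxE [map_mx polyC _ _ _]mxE /= coefMC.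
Qed.

(** On the diagonal the pencil is [1 + 'X] times [w], so homogeneity pulls out [(1 + 'X) ^+ r]. *)
Lemma polar_diag d r w : polar d r w w = 'C(r, d)%:R *: monv r w.
Proof.
have pencilE : pencil r w w = (1 + 'X) ^+ r *: map_mx polyC (monv r w).
  rewrite map_monv -monvZ; congr monv.
  by rewrite scalerDl scale1r.
apply/rowP => j; rewrite /polar pencilE !mxE /= coefMC; congr (_ * _).
have := coef_expr_linear (1 : K) 1 r d.
by rewrite polyC1 mulr1 !expr1n !mulr1.
Qed.

(** The coefficient is bihomogeneous of bidegree [(r1, r2)], hence linear in the tensor of
    monomials. The factor [1%:M] matches the degree of [symdet_repr], a product with a character. *)
Lemma polar_mx_exists r1 r2 :
  {B : 'M[K]_(r1.+1 * r2.+1, (r1 + r2).+1 * 1) | forall w1 w2,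
    tprod (monv r1 w1) (monv r2 w2) *m B
    = tprod (polar r2 (r1 + r2) w1 w2) (1%:M : 'M_1)}.
Proof.
(* x1^(r1-i) y1^i x2^(r2-k) y2^k comes from x^(n-j) y^j with j = i + k by choosing
   which r2 - k of the x and which k of the y are evaluated at the second point. *)
pose c (i : 'I_r1.+1) (k : 'I_r2.+1) : 'rV[K]_(r1 + r2).+1 :=
  \row_j if (i + k == j)%N then ('C(r1 + r2 - j, r2 - k) * 'C(j, k))%:R else 0.
have [B Bc] := tprod_mul_exists (fun i k => tprod (c i k) (1%:M : 'M[K]_1)).
exists B => w1 w2; rewrite {}Bc.
have -> : polar r2 (r1 + r2) w1 w2
    = \sum_i \sum_k (monv r1 w1 0 i * monv r2 w2 0 k) *: c i k.
  apply/rowP => j; rewrite exchange_big summxE !mxE /= coefMr.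
  apply: eq_bigr => k _; rewrite summxE !mxE -!/(_%:P) !coef_expr_linear.
  have ltk := ltn_ord k; have ltj := ltn_ord j.
  case: (boolP ((k <= j)%N && (j - k <= r1)%N)) => [/andP[kj jk]|bad].
    have lti : (j - k < r1.+1)%N by [].
    rewrite (bigD1 (Ordinal lti)) //= !mxE /= subnK // eqxx.
    rewrite [X in _ = _ + X]big1 => [|i ij]; last first.
      rewrite !mxE ifN ?mulr0 //; apply: contraNneq ij => ij.
      by apply/eqP/val_inj; rewrite /= -ij addnK.
    have -> : (r1 + r2 - j - (r2 - k) = r1 - (j - k))%N by lia.
    by rewrite addr0 natrM; ring.
  (* No [i] satisfies [i + k = j] here. The left side vanishes too: ['C(j, k)] is 0 if [j < k], and
     otherwise [r2 - k] exceeds [r1 + r2 - j]. *)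
  rewrite big1 => [|i _]; last first.
    rewrite !mxE ifN ?mulr0 //; apply: contraNneq bad => <-.
    by rewrite leq_addl addnK; exact: (ltn_ord i).
  have [kj|jk] := leqP k j; last by rewrite ['C(j, k)]bin_small // !(mul0r, mulr0).
  rewrite ['C(_, r2 - k)]bin_small ?mul0r //; move: bad; rewrite kj /=; lia.
rewrite -[RHS]/(tprodl _ _) raddf_sum; apply: eq_bigr => i _.
rewrite raddf_sum; apply: eq_bigr => k _; exact/esym/tprodZl.
Qed.

End Polarization.

(** * Multiplication by the cross product *)

Section MulCross.

Variable K : fieldType.

(** Multiplication by x and by y on coordinate columns: the index is the exponent of y, so only y
    raises it. *)
Definition mulx_mx r : 'M[K]_(r.+2, r.+1) := \matrix_(i, j) (i == j :> nat)%:R.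
Definition muly_mx r : 'M[K]_(r.+2, r.+1) := \matrix_(i, j) (i == j.+1 :> nat)%:R.

Lemma monv_mulx r (w : 'rV[K]_2) :
  monv r.+1 w *m mulx_mx r = w 0 0 *: monv r w.
Proof.
apply/rowP => j; rewrite mxE (bigD1 (widen_ord (leqnSn _) j)) //= !mxE eqxx.
rewrite mulr1 subSn ?exprS ?mulrA; last exact: (ltn_ord j).
rewrite big1 ?addr0 // => i ij; rewrite !mxE.
by rewrite [_ == _](negPf ij) mulr0.
Qed.

Lemma monv_muly r (w : 'rV[K]_2) :
  monv r.+1 w *m muly_mx r = w 0 1 *: monv r w.
Proof.
apply/rowP => j; rewrite mxE (bigD1 (lift ord0 j)) //= !mxE eqxx mulr1.
rewrite lift0 subSS exprS mulrCA.
by rewrite big1 ?addr0 // => i ij; rewrite !mxE [_ == _](negPf ij) mulr0.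
Qed.

Definition mulcross_mx r1 r2 : 'M[K]_(r1.+2 * r2.+2, r1.+1 * r2.+1) :=
  tprod (mulx_mx r1) (muly_mx r2) - tprod (muly_mx r1) (mulx_mx r2).

Lemma tprod_mulcross r1 r2 w1 w2 :
  tprod (monv r1.+1 w1) (monv r2.+1 w2) *m mulcross_mx r1 r2
  = cross w1 w2 *: tprod (monv r1 w1) (monv r2 w2).
Proof.
rewrite mulmxBr -!tprodE !monv_mulx !monv_muly.
by rewrite !tprodZl !tprodZr !scalerA scalerBl.
Qed.

End MulCross.

(** The cross product can be cancelled wherever it is nonzero, and such pairs of points suffice. *)
Lemma mulcross_inj (K : closedFieldType) r1 r2 n (A : 'M[K]_(r1.+1 * r2.+1, n)) :
  mulcross_mx K r1 r2 *m A = 0 -> A = 0.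
Proof.
move=> A0; apply: tprod_monv_eq0 => w1 w2 w12.
apply: (scalerI w12); rewrite scaler0 scalemxAl -tprod_mulcross.
by rewrite -mulmxA A0 mulmx0.
Qed.

(** * Similarity and direct sums *)

Section Similarity.

Variables (K : fieldType) (gT : finGroupType) (G : {group gT}).

Lemma mx_rsim_eq n (rG1 rG2 : mx_representation K G n) :
  (forall g, g \in G -> rG1 g = rG2 g) -> mx_rsim rG1 rG2.
Proof.
move=> eqG; exists 1%:M => // [|g Gg]; first by rewrite row_free_unit unitmx1.
by rewrite mulmx1 mul1mx eqG.
Qed.

Lemma mx_rsim_daddr (rG1 rG2 rG2' : representation K G) :
  mx_rsim rG2 rG2' -> mx_rsim (dadd_grepr rG1 rG2) (dadd_grepr rG1 rG2').
Proof.
(* Identifying the degrees first makes [B] square, so that [row_free] means invertible. *)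
case: rG1 rG2 rG2' => n1 rG1 [n2 rG2] [n2' rG2'] /= [B en]; case: _ / en in rG2' B *.
move=> Bfree hom.
exists (block_mx 1%:M 0 0 B) => // [|g Gg].
  rewrite row_free_unit unitmxE det_ublock det1 mul1r -unitmxE.
  by rewrite -row_free_unit.
by rewrite /= !mulmx_block !(mulmx0, mul0mx, mulmx1, mul1mx, addr0, add0r) hom.
Qed.

(** The injectivity hypothesis makes the columns of [row_mx B1 B2] independent; by equality of
    degrees its rows are independent too, as [mx_rsim] requires. *)
Lemma mx_rsim_row_mx (rG rG1 rG2 : representation K G)
    (B1 : 'M_(rdegree rG, rdegree rG1)) (B2 : 'M_(rdegree rG, rdegree rG2)) :
  rdegree rG = (rdegree rG1 + rdegree rG2)%N ->
  (forall u v, B1 *m u + B2 *m v = 0 :> 'cV_(rdegree rG) -> u = 0 /\ v = 0) ->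
  (forall g, g \in G -> rG g *m B1 = B1 *m rG1 g) ->
  (forall g, g \in G -> rG g *m B2 = B2 *m rG2 g) ->
  mx_rsim rG (dadd_grepr rG1 rG2).
Proof.
move=> en inj hom1 hom2; exists (row_mx B1 B2) => // [|g Gg]; last first.
  by rewrite mul_row_block !mulmx0 addr0 add0r mul_mx_row hom1 ?hom2.
have freeT : row_free (row_mx B1 B2)^T.
  apply: inj_row_free => v /(congr1 trmx).
  rewrite trmx_mul trmxK trmx0 -[v^T]vsubmxK mul_row_col => /inj[u0 v0].
  by rewrite -[v]trmxK -[v^T]vsubmxK u0 v0 col_mx0 trmx0.
by rewrite /row_free -mxrank_tr (eqP freeT) en.
Qed.

End Similarity.

(** * Equivariance and the induction *)

Section ClebschGordan.

Variables (K : closedFieldType) (F : finFieldType) (h : {rmorphism F -> K}).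

(** Twisting by a scalar instead of a tensor factor keeps the degree [r1.+1 * r2.+1]; [m] counts the
    determinants accumulated in the induction. *)
Lemma tensor_det_mx_repr r1 r2 m : mx_repr 'GL_2[F] (fun g : {'GL_2[F]} =>
  h (\det g) ^+ m *: tprod (sym_mx r1 (map_mx h g)) (sym_mx r2 (map_mx h g))).
Proof.
split=> [|g g' _ _].
  by rewrite GL_1E map_mx1 !sym_mx1 tprod1 det1 rmorph1 expr1n scale1r.
rewrite GL_MxE map_mxM !sym_mxM det_mulmx rmorphM exprMn tprodE.
by rewrite -scalemxAl -scalemxAr scalerA.
Qed.

Definition tensor_det_repr r1 r2 m :=
  Representation (MxRepresentation (tensor_det_mx_repr r1 r2 m)).

Definition symdet r k := Representation (symdet_repr h r k).

Lemma bin_natf_neq0 n d : n`!%:R != 0 :> K -> (d <= n)%N -> 'C(n, d)%:R != 0 :> K.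
Proof.
move=> n0 dn; apply: contraNneq n0 => C0.
by rewrite -(bin_fact dn) natrM C0 mul0r.
Qed.

(** By [polar_diag], on the diagonal [B *m u] pairs with monomials as a nonzero multiple of [u]
    does; the tensor factor [y] of size 1 is only a scalar. *)
Lemma polar_inj r1 r2 (B : 'M[K]_(r1.+1 * r2.+1, (r1 + r2).+1 * 1))
    n (u : 'M[K]_((r1 + r2).+1 * 1, n)) :
  (r1 + r2)`!%:R != 0 :> K ->
  (forall w1 w2, tprod (monv r1 w1) (monv r2 w2) *m B
    = tprod (polar r2 (r1 + r2) w1 w2) (1%:M : 'M_1)) ->
  (forall w, tprod (monv r1 w) (monv r2 w) *m (B *m u) = 0) -> u = 0.
Proof.
move=> fact0 polB Bu0; apply: tprod_rows_eq0 => x y.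
pose L : {linear 'rV_(r1 + r2).+1 -> 'M_(1 * 1, n)} := mulmxr u \o tprodl y.
apply: (@monv_separates _ 0 _ _ _ L) => t _ /=.
have := Bu0 (affine_point t); rewrite mulmxA polB polar_diag.
rewrite tprodZl -scalemxAl => /eqP.
rewrite scaler_eq0 (negPf (bin_natf_neq0 fact0 (leq_addl _ _))) /= => /eqP tu0.
rewrite /tprodl [y]mx11_scalar -scalemx1 tprodZr -scalemxAl.
by rewrite tu0 scaler0.
Qed.

Lemma polar_hom r1 r2 m (B : 'M[K]_(r1.+1 * r2.+1, (r1 + r2).+1 * 1)) g :
  (forall w1 w2, tprod (monv r1 w1) (monv r2 w2) *m B
    = tprod (polar r2 (r1 + r2) w1 w2) (1%:M : 'M_1)) ->
  tensor_det_repr r1 r2 m g *m B = B *m symdet (r1 + r2) m g.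
Proof.
move=> polB; apply/eqP; rewrite -subr_eq0; apply/eqP.
apply: tprod_monv_eq0 => w1 w2 _; apply/eqP; rewrite mulmxBr subr_eq0; apply/eqP.
rewrite [in RHS]mulmxA polB /= -tprodE polar_sym mul1mx -scalemx1 tprodZr.
by rewrite mulmxA -scalemxAr -tprodE !monv_sym -scalemxAl polB.
Qed.

(** Moving both points by [g] multiplies the cross product by the determinant, whence the exponent
    [m.+1]. *)
Lemma mulcross_hom r1 r2 m g :
  tensor_det_repr r1.+1 r2.+1 m g *m mulcross_mx K r1 r2
  = mulcross_mx K r1 r2 *m tensor_det_repr r1 r2 m.+1 g.
Proof.
apply/eqP; rewrite -subr_eq0; apply/eqP.
apply: tprod_monv_eq0 => w1 w2 _; apply/eqP; rewrite mulmxBr subr_eq0; apply/eqP.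
rewrite !mulmxA tprod_mulcross /= -!scalemxAr -!scalemxAl -!tprodE !monv_sym.
rewrite tprod_mulcross cross_mulmx !scalerA det_map_mx exprS.
by congr (_ *: _); ring.
Qed.

(** Polarization alone is bijective here; [grepr0], of degree 0, ends the iterated sum. *)
Lemma tensor_det_rsim0 r m : r`!%:R != 0 :> K ->
  mx_rsim (tensor_det_repr r 0 m) (dadd_grepr (symdet r m) grepr0).
Proof.
rewrite -{1}(addn0 r) => fact0.
have -> : symdet r m = symdet (r + 0) m by rewrite addn0.
have [B polB] := polar_mx_exists K r 0.
apply: (mx_rsim_row_mx (rG := tensor_det_repr r 0 m)
  (rG1 := symdet (r + 0) m) (rG2 := grepr0) (B1 := B) (B2 := 0)).
- by rewrite /= !muln1 !addn0.
- move=> u v; rewrite mul0mx addr0 => Bu0; split; last exact: flatmx0.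
  by apply: (polar_inj fact0 polB) => w; rewrite Bu0 mulmx0.
- by move=> g _; exact: polar_hom.
by move=> g _; rewrite mulmx0 mul0mx.
Qed.

Lemma tensor_det_rsimS r1 r2 m : (r1.+1 + r2.+1)`!%:R != 0 :> K ->
  mx_rsim (tensor_det_repr r1.+1 r2.+1 m)
    (dadd_grepr (symdet (r1.+1 + r2.+1) m) (tensor_det_repr r1 r2 m.+1)).
Proof.
move=> fact0; have [B polB] := polar_mx_exists K r1.+1 r2.+1.
apply: (mx_rsim_row_mx (rG := tensor_det_repr r1.+1 r2.+1 m)
  (rG1 := symdet (r1.+1 + r2.+1) m) (rG2 := tensor_det_repr r1 r2 m.+1)
  (B1 := B) (B2 := mulcross_mx K r1 r2)).
- by rewrite /=; lia.
- move=> u v sum0.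
  have u0 : u = 0.
    apply: (polar_inj fact0 polB) => w.
    rewrite -[B *m u](addrK (mulcross_mx K r1 r2 *m v)) sum0 sub0r mulmxN mulmxA.
    by rewrite tprod_mulcross /cross mulrC subrr scale0r mul0mx oppr0.
  by split=> //; apply: mulcross_inj; move: sum0; rewrite u0 mulmx0 add0r.
- by move=> g _; exact: polar_hom.
by move=> g _; exact: mulcross_hom.
Qed.

(** The factorial hypothesis descends along the induction, since [(r1 + r2)!] divides the factorial
    of the larger sum. As [k <= r2 <= r1], the subtraction is never truncated. *)
Lemma Clebsch_Gordan r1 r2 m : (r2 <= r1)%N -> (r1 + r2)`!%:R != 0 :> K ->
  mx_rsim (tensor_det_repr r1 r2 m)
    (\big[@dadd_grepr K _ 'GL_2[F]/grepr0]_(k < r2.+1)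
       symdet (r1 + r2 - 2 * k) (k + m)).
Proof.
elim: r2 r1 m => [|r2 IH] [|r1] m // le21 fact0; rewrite big_ord_recl.
- by rewrite big_ord0 muln0 subn0; exact: tensor_det_rsim0.
- by rewrite big_ord0 muln0 subn0 addn0 in fact0 *; exact: tensor_det_rsim0.
rewrite muln0 subn0; apply: mx_rsim_trans (tensor_det_rsimS _ fact0) _.
(* The total degree drops by 2 and the twist grows by 1, which is the passage from [k] to
   [k + 1]. *)
have shift (k : 'I_r2.+1) : symdet (r1 + r2 - 2 * k) (k + m.+1)
    = symdet (r1.+1 + r2.+1 - 2 * lift ord0 k) (lift ord0 k + m).
  by rewrite lift0 addSnnS; congr symdet; lia.
apply: mx_rsim_daddr; rewrite -(eq_bigr _ (fun k _ => shift k)).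
apply: IH => //; apply: contraNneq fact0 => fact0.
by rewrite addSn addnS !factS !natrM fact0 !mulr0.
Qed.

End ClebschGordan.

(** * Factorials in characteristic [p] and restriction to the prime field *)

Lemma natf_fact_neq0 (R : idomainType) p n :
  p \in [pchar R] -> (n < p)%N -> n`!%:R != 0 :> R.
Proof.
move=> chp; have p_pr := pcharf_prime chp; elim: n => [|n IH] np.
  by rewrite oner_eq0.
rewrite factS natrM mulf_neq0 ?IH 1?ltnW //.
by rewrite -(dvdn_pcharf chp) gtnNdvd.
Qed.

Theorem theorem3p6 (p : nat) (p_pr : prime p)
  (Fq : finFieldType) (cardFq : #|Fq| = (p ^ 2)%N)
  (K : closedFieldType)
  (i : {rmorphism 'F_p -> Fq}) (f : {rmorphism Fq -> K})
  (algK : integralRange (f \o i))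
  (r1 r2 : nat) (le_r2_r1 : (r2 <= r1)%N) (lt_r1 : (r1 < p - r2)%N) :
  mx_rsim
    (GLres i (Vvec_repr (rmorph_pchar i (pchar_Fp p_pr)) f r1 r2))
    (\big[@dadd_grepr K _ 'GL_2['F_p]/grepr0]_(k < r2.+1)
       Representation (symdet_repr (f \o i) (r1 + r2 - 2 * k) k)).
Proof.
have chK : p \in [pchar K].
  exact: (rmorph_pchar (f \o i) (pchar_Fp p_pr)).
have fact0 : (r1 + r2)`!%:R != 0 :> K by apply: natf_fact_neq0 chK _; lia.
(* Since [x ^+ p = x] in the prime field, both tensor factors become symmetric powers along
   [f \o i]. *)
have frobE (x : 'F_p) :
    pFrobenius_aut (rmorph_pchar i (pchar_Fp p_pr)) (i x) = i x.
  by rewrite pFrobenius_autE -rmorphXn -[in X in _ ^+ X](card_Fp p_pr) expf_card.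
have mapfE (g : 'M['F_p]_2) : map_mx f (map_mx i g) = map_mx (f \o i) g.
  by apply/matrixP => a b; rewrite !mxE.
have mapFrobE (g : 'M['F_p]_2) :
    map_mx (f \o pFrobenius_aut (rmorph_pchar i (pchar_Fp p_pr))) (map_mx i g)
    = map_mx (f \o i) g.
  by apply/matrixP => a b; rewrite !mxE /= frobE.
have := Clebsch_Gordan (f \o i) 0 le_r2_r1 fact0.
under eq_bigr => k _ do rewrite addn0.
apply: mx_rsim_trans; apply: mx_rsim_eq => g _ /=.
by rewrite mapFrobE mapfE scale1r.
Qed.
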